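(* Let $n\ge1$ and $Q=2n+2$. If $1<q<\frac{n+1}{n}$ and $0<p\le Q\,(2+\frac{Q}{q})^{-1}$, then $\mathcal{H}^{p}_{q,2}(\mathbb{H}^{n})=\{0\}$.
   Context: Heisenberg group: $\mathbb{H}^n=\mathbb{R}^{2n}\times\mathbb{R}$ with group law $(x,t)\cdot(y,s)=(x+y,\,t+s+x^{t}Jy)$, $J=2\begin{pmatrix}0&-I_n\\ I_n&0\end{pmatrix}$, inverse $(x,t)^{-1}=(-x,-t)$, Koranyi norm $\rho(x,t)=(|x|^4+t^2)^{1/4}$, balls $B(z_0,\delta)=\{w:\rho(z_0^{-1}\cdot w)<\delta\}$. Haar measure is Lebesgue measure on $\mathbb{R}^{2n+1}$; $|E|$ is the measure of $E$. For a multi-index $I=(i_1,\dots,i_{2n+1})\in(\mathbb{N}\cup\{0\})^{2n+1}$: $z^I=x_1^{i_1}\cdots x_{2n}^{i_{2n}}t^{i_{2n+1}}$ for $z=(x,t)$, and $d(I)=i_1+\cdots+i_{2n}+2i_{2n+1}$. Calderón–Hardy space with $\gamma=2$ (so $k=1$): for $1<q<\infty$ and $g\in L^q_{loc}(\mathbb{H}^n)$ put $|g|_{q,B}=(|B|^{-1}\int_B|g|^q)^{1/q}$ and $\eta_{q,2}(g;z)=\sup_{r>0}r^{-2}|g|_{q,B(z,r)}$. Let $\mathcal{P}_1$ be the space of polynomials $\sum_{d(I)\le1}c_Iz^I$, $c_I\in\mathbb{C}$, and $E^q_1=L^q_{loc}(\mathbb{H}^n)/\mathcal{P}_1$. For $G\in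 E^q_1$ put $N_{q,2}(G;z)=\inf\{\eta_{q,2}(g;z):g\in G\}$. For $0<p<\infty$, $\mathcal{H}^p_{q,2}(\mathbb{H}^n)$ is the set of $G\in E^q_1$ with $N_{q,2}(G;\cdot)\in L^p(\mathbb{H}^n)$. *)

(* Defs.v *)
From HB Require Import structures.
From mathcomp Require Import all_boot all_order all_algebra.
From mathcomp Require Import all_classical all_reals all_analysis.
From mathcomp Require Import measurable_realfun.
From mathcomp Require Import complex.

Set Implicit Arguments.
Unset Strict Implicit.
Unset Printing Implicit Defensive.

Import Order.TTheory GRing.Theory Num.Theory.
Import numFieldNormedType.Exports.

Local Open Scope classical_set_scope.
Local Open Scope ring_scope.
Local Open Scope complex_scope.

(** The canonical sigma-finite structure on [m1 \x m2] is keyed on products of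
    sub-probabilities; this copy of the product measure carries it for arbitrary
    sigma-finite measures. *)
Section sigma_finite_product.
Local Open Scope ereal_scope.
Context d1 d2 (T1 : measurableType d1) (T2 : measurableType d2) (R : realType).
Variable m1 : {sigma_finite_measure set T1 -> \bar R}.
Variable m2 : {sigma_finite_measure set T2 -> \bar R}.

Definition sf_product : set (T1 * T2) -> \bar R := m1 \x m2.

HB.instance Definition _ := Measure.copy sf_product (m1 \x m2).

Let sf_product_sigma_finite : sigma_finite setT sf_product.
Proof.
have /sigma_finiteP[F [TF ndF Foo]] := sigma_finiteT m1.
have /sigma_finiteP[G [TG ndG Goo]] := sigma_finiteT m2.
exists (fun i => F i `*` G i).
  rewrite -setXTT TF TG; apply/seteqP; split.
    move=> [x y] [/= [i _ Fix] [j _ Gjy]]; exists (maxn i j) => //; split.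
    - by move: x Fix; exact/subsetPset/ndF/leq_maxl.
    - by move: y Gjy; exact/subsetPset/ndG/leq_maxr.
  by move=> [x y] [i _ []/= ? ?]; split; exists i.
move=> k; have [? ?] := Foo k; have [? ?] := Goo k.
split; first exact: measurableX.
by rewrite /sf_product product_measure1E// lte_mul_pinfty// ge0_fin_numE.
Qed.

HB.instance Definition _ := Measure_isSigmaFinite.Build _ _ _ sf_product
  sf_product_sigma_finite.

End sigma_finite_product.

(** Row vectors carry the sigma-algebra generated by the coordinate functions
    (the Borel sets of R^m), and [lebesgue_rV m] is the m-fold product of the
    one-dimensional Lebesgue measure. *)
Section lebesgue_rV.
Context {R : realType}.

Section measurable_rV.
Variable m : nat.

Let coord (i : 'I_m) (x : 'rV[R]_m) : measurableTypeR R := x ord0 i.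

Let rV_set0 : g_sigma_preimage coord set0.
Proof. exact: sigma_algebra0. Qed.

Let rV_setC A : g_sigma_preimage coord A -> g_sigma_preimage coord (~` A).
Proof. exact: sigma_algebraC. Qed.

Let rV_bigcup (F : (set 'rV[R]_m)^nat) :
  (forall i, g_sigma_preimage coord (F i)) ->
  g_sigma_preimage coord (\bigcup_i F i).
Proof. exact: sigma_algebra_bigcup. Qed.

HB.instance Definition _ := @isMeasurable.Build default_measure_display
  'rV[R]_m (g_sigma_preimage coord) rV_set0 rV_setC rV_bigcup.

Lemma measurable_coord (i : 'I_m) :
  measurable_fun [set: 'rV[R]_m] (fun x => x ord0 i : measurableTypeR R).
Proof.
move=> _ Y mY; rewrite setTI; apply: sub_sigma_algebra => /=.
rewrite -bigcup_seq/=; exists i => /=; first by rewrite mem_index_enum.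
by exists Y => //; rewrite setTI.
Qed.

Lemma measurable_fun_rV d (T : measurableType d) (f : T -> 'rV[R]_m) :
  (forall i, measurable_fun setT (fun t => f t ord0 i : measurableTypeR R)) ->
  measurable_fun setT f.
Proof.
move=> mf _ Y mY; rewrite setTI.
suff: g_sigma_preimage coord `<=` [set A | measurable (f @^-1` A)] by apply.
apply: smallest_sub.
  split => /=; first by rewrite preimage_set0.
    by move=> A mA; rewrite setTD preimage_setC; exact: measurableC.
  by move=> F mF; rewrite preimage_bigcup; exact: bigcup_measurable.
rewrite -bigcup_seq => A [i _ [B mB <-]] /=.
by have := mf i measurableT B mB; rewrite !setTI.
Qed.

End measurable_rV.

Definition cons_rV m (u : measurableTypeR R * 'rV[R]_m) : 'rV[R]_m.+1 :=
  \row_j (if unlift ord0 j is Some k then u.2 ord0 k else u.1).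

Definition uncons_rV m (x : 'rV[R]_m.+1) : measurableTypeR R * 'rV[R]_m :=
  (x ord0 ord0, \row_k x ord0 (lift ord0 k)).

Lemma cons_rVK m : cancel (@cons_rV m) (@uncons_rV m).
Proof.
move=> [a x]; rewrite /uncons_rV mxE unlift_none; congr pair.
by apply/rowP => k; rewrite !mxE liftK.
Qed.

Lemma measurable_cons_rV m : measurable_fun setT (@cons_rV m).
Proof.
apply: measurable_fun_rV => i; under eq_fun do rewrite mxE.
case: unliftP => [j _|_]; last exact: measurable_fst.
exact: (measurableT_comp (measurable_coord j) measurable_snd).
Qed.

Lemma measurable_uncons_rV m : measurable_fun setT (@uncons_rV m).
Proof.
apply: measurable_fun_pair; first exact: measurable_coord.
apply: measurable_fun_rV => i.
by under eq_fun do rewrite mxE; exact: measurable_coord.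
Qed.

Section lebesgue_rVS.
Local Open Scope ereal_scope.
Variables (m : nat) (mu : {sigma_finite_measure set 'rV[R]_m -> \bar R}).

Definition lebesgue_rVS : set 'rV[R]_m.+1 -> \bar R :=
  pushforward (sf_product (@lebesgue_measure R) mu) (@cons_rV m).

Let preim_cons A : measurable A -> measurable (@cons_rV m @^-1` A).
Proof.
by move=> mA; rewrite -[X in measurable X]setTI; exact: measurable_cons_rV.
Qed.

Let lebesgue_rVS0 : lebesgue_rVS set0 = 0.
Proof. by rewrite /lebesgue_rVS /pushforward preimage_set0 measure0. Qed.

Let lebesgue_rVS_ge0 A : 0 <= lebesgue_rVS A.
Proof. exact: (measure_ge0 (sf_product (@lebesgue_measure R) mu)). Qed.

Let lebesgue_rVS_sigma_additive : semi_sigma_additive lebesgue_rVS.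
Proof.
move=> F mF tF mUF; rewrite /lebesgue_rVS /pushforward preimage_bigcup.
apply: measure_semi_sigma_additive.
- by move=> i; exact: preim_cons.
- apply/trivIsetP => i j _ _ ij; rewrite -preimage_setI.
  by move/trivIsetP : tF => ->//; rewrite preimage_set0.
- by rewrite -preimage_bigcup; exact: preim_cons.
Qed.

HB.instance Definition _ := isMeasure.Build _ _ _ lebesgue_rVS
  lebesgue_rVS0 lebesgue_rVS_ge0 lebesgue_rVS_sigma_additive.

Let lebesgue_rVS_sigma_finite : sigma_finite setT lebesgue_rVS.
Proof.
have [F TF mF] := sigma_finiteT (sf_product (@lebesgue_measure R) mu).
exists (fun i => @uncons_rV m @^-1` F i).
  by rewrite -preimage_bigcup -TF preimage_setT.
move=> i; have [mFi Fioo] := mF i; split.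
  by rewrite -[X in measurable X]setTI; exact: measurable_uncons_rV.
rewrite /lebesgue_rVS /pushforward -comp_preimage.
by rewrite (_ : _ \o _ = id) ?preimage_id//; apply/funext => u /=; rewrite cons_rVK.
Qed.

HB.instance Definition _ := Measure_isSigmaFinite.Build _ _ _ lebesgue_rVS
  lebesgue_rVS_sigma_finite.

End lebesgue_rVS.

Fixpoint lebesgue_rV m : {sigma_finite_measure set 'rV[R]_m -> \bar R} :=
  if m is m'.+1 then lebesgue_rVS (lebesgue_rV m')
  else dirac (0 : 'rV[R]_0).

Lemma lebesgue_rV_box m (A : 'I_m -> set (measurableTypeR R)) :
  (forall i, measurable (A i)) ->
  lebesgue_rV m [set x | forall i, A i (x ord0 i)] =
  (\prod_(i < m) lebesgue_measure (A i))%E.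
Proof.
elim: m A => [|m IHm] A mA.
  by rewrite big_ord0 /= diracE mem_set//; case.
have mB : measurable [set x : 'rV[R]_m | forall k, A (lift ord0 k) (x ord0 k)].
  rewrite (_ : mkset _ = \bigcap_(k in [set: 'I_m])
      ((fun x : 'rV[R]_m => x ord0 k) @^-1` A (lift ord0 k))); last first.
    by apply/seteqP; split => x Ax k; [move=> _|]; exact: Ax.
  apply: fin_bigcap_measurable => // k _.
  by rewrite -[X in measurable X]setTI; exact: measurable_coord.
rewrite big_ord_recl -IHm => [|i]; last exact: mA.
rewrite -product_measure1E//=; congr product_measure1.
apply/seteqP; split => [[a x]/= Aax|[a x] [/= Aa Ax] i]; last first.
  by rewrite mxE; case: unliftP => [k ->|->].
split => [|k] /=; first by have := Aax ord0; rewrite mxE unlift_none.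
by have := Aax (lift ord0 k); rewrite mxE liftK.
Qed.

End lebesgue_rV.

(** [measurableTypeR R] is the type [R] equipped with
    the Borel sigma-algebra on which [lebesgue_measure] lives. *)
Section heisenberg.
Context {R : realType}.

Definition heis n : Type := ('rV[R]_(n + n) * measurableTypeR R)%type.

Definition heisJ n : 'M[R]_(n + n) := 2 *: block_mx 0 (- 1%:M) 1%:M 0.

Definition hmul n (z w : heis n) : heis n :=
  (z.1 + w.1,
   (z.2 : R) + (w.2 : R) + (z.1 *m heisJ n *m w.1^T) ord0 ord0).

Definition hinv n (z : heis n) : heis n := (- z.1, - (z.2 : R)).

(** The norm [`| x |] of the library is the sup norm on matrices. *)
Definition euclid m (x : 'rV[R]_m) : R := Num.sqrt (\sum_i x ord0 i ^+ 2).

Definition koranyi n (z : heis n) : R :=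
  (euclid z.1 ^+ 4 + (z.2 : R) ^+ 2) `^ 4^-1.

Definition hball n (z : heis n) (r : R) : set (heis n) :=
  [set w | koranyi (hmul (hinv z) w) < r].

Definition haar n : {sigma_finite_measure set (heis n) -> \bar R} :=
  sf_product (lebesgue_rV (n + n)) (@lebesgue_measure R).

Definition hdim n : R := (2 * n + 2)%:R.

(** Since [d(I) <= k] bounds every entry of [I] by [k], only multi-indices
    with entries in [0, k] occur in polynomials of homogeneous degree at most
    [k]; restricting to them makes the index type finite. *)
Definition multi_index n k : finType :=
  ({ffun 'I_(n + n) -> 'I_k.+1} * 'I_k.+1)%type.

Definition hdeg n k (I : multi_index n k) : nat :=
  (\sum_j (I.1 j : nat) + 2 * I.2)%N.

Definition hmonomial n k (I : multi_index n k) (z : heis n) : R :=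
  (\prod_j z.1 ord0 j ^+ I.1 j) * (z.2 : R) ^+ I.2.

Definition hpoly n k : set (heis n -> R[i]) :=
  [set P | exists c : multi_index n k -> R[i],
     P = fun z => \sum_(I | (hdeg I <= k)%N) c I * (hmonomial I z)%:C].

Definition int_powq n (q : R) (B : set (heis n)) (g : heis n -> R[i]) : \bar R :=
  (\int[haar n]_(w in B) (Normc.normc (g w) `^ q)%:E)%E.

Definition Lq_loc n (q : R) : set (heis n -> R[i]) :=
  [set g | [/\ measurable_fun [set: heis n] (fun z => complex.Re (g z)),
               measurable_fun [set: heis n] (fun z => complex.Im (g z)) &
               forall K : set (heis n), compact K ->
                 (int_powq q K g < +oo)%E]].

Definition qmean n (q : R) (B : set (heis n)) (g : heis n -> R[i]) : \bar R :=
  (((haar n B)^-1 * int_powq q B g) `^ q^-1)%E.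

Definition eta2 n (q : R) (g : heis n -> R[i]) (z : heis n) : \bar R :=
  ereal_sup [set ((r ^- 2)%:E * qmean q (hball z r) g)%E | r in [set r | 0 < r]].

(** Elements of L^q_loc / P_1 are represented as cosets: sets of functions that
    are closed under almost everywhere equality, so that the passage from
    functions to their classes in L^q_loc is part of the same quotient. *)
Definition coset1 n (q : R) (g : heis n -> R[i]) : set (heis n -> R[i]) :=
  [set h | Lq_loc q h /\ exists2 P, hpoly 1 P &
             {ae haar n, forall z, h z = g z + P z}].

Definition E1 n (q : R) : set (set (heis n -> R[i])) :=
  [set G | exists2 g, Lq_loc q g & G = coset1 q g].

Definition E1_zero n (q : R) : set (heis n -> R[i]) := coset1 q (fun=> 0).

Definition N2 n (q : R) (G : set (heis n -> R[i])) (z : heis n) : \bar R :=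
  ereal_inf [set eta2 q g z | g in G].

(** Membership in L^p, up to almost everywhere equality with a Borel function
    (equivalently, for functions measurable with respect to the completed
    sigma-algebra). *)
Definition in_Lp n (p : R) (f : heis n -> \bar R) : Prop :=
  exists h : heis n -> \bar R,
    [/\ measurable_fun [set: heis n] h, {ae haar n, forall z, f z = h z} &
        ('N[haar n]_(p%:E)[h] < +oo)%E].

Definition calderon_hardy n (p q : R) : set (set (heis n -> R[i])) :=
  [set G | E1 q G /\ in_Lp p (N2 q G)].

End heisenberg.

(* Main.v *)
Require Import Defs.
From mathcomp Require Import all_boot all_order all_algebra.
From mathcomp Require Import all_classical all_reals all_analysis.
From mathcomp Require Import ring lra zify measurable_realfun complex.
Import Order.TTheory GRing.Theory Num.Theory.
Import numFieldNormedType.Exports.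
Local Open Scope classical_set_scope.
Local Open Scope ring_scope.

(** The maximal function $N_{q,2}(G; \cdot)$ of a nonzero class cannot decay
    faster than $\rho(z)^{-2-Q/q}$ at infinity, and for
    $p (2 + Q/q) \le Q$ this rate is not $p$-integrable there.

    Let $g$ represent $G$, and suppose that $g$ is not almost everywhere equal
    to a polynomial of $\mathcal{P}_1$. Then there are a cube $D$ around the
    origin and a $\kappa > 0$ with $\int_D |g + P|^q \ge \kappa$ for all $P$
    in $\mathcal{P}_1$ ([coset1_zero_or_far]). Indeed $\mathcal{P}_1$ is
    finite-dimensional, hence closed in $L^1(D)$
    ([attained_or_far_span]): for each $D$, either $g$ coincides almost
    everywhere on $D$ with a polynomial or it stays at a positive
    $L^1(D)$-distance from all of them, and a positive lower bound on an
    $L^1(D)$-norm gives one on the $L^q(D)$-norm ([int_powR_ge]). The first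
    alternative cannot hold on every cube of an exhaustion, because an element
    of $\mathcal{P}_1$ is affine in $x$ and so is determined by its values
    almost everywhere on one cube ([haffine_ae0]); the polynomials obtained on
    the various cubes would agree.

    Let $z$ have size about $X \ge 1$, in the sense that $|x_i| \le X$ and
    $|t| \le 4 X^2$. The ball $B(z, MX)$ contains $D$ for a constant $M$
    ([hcube_sub_hball]), and its measure is at most a multiple of $X^Q$
    ([haar_hball_le]). Taking $r = MX$ in the supremum that defines
    $\eta_{q,2}$ gives $N_{q,2}(G; z) \ge C X^{-2-Q/q}$ ([N2_shell_ge]). The
    disjoint dyadic shells $\{|x_i| \le 2^k, 4^k < t \le 4^{k+1}\}$ have
    measure at least $2^{kQ}$, so each of them contributes at least the
    constant $C^p$ to $\int N_{q,2}(G; z)^p \, dz$, which is therefore infinite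
    ([not_in_Lp]). *)

(** * Finite-dimensional subspaces of a seminormed space *)

Lemma near_natSinv_lt (R : realType) (e : R) :
  0 < e -> \forall k \near \oo, k.+1%:R^-1 < e.
Proof. by move=> e0; exact: (near_infty_natSinv_lt (PosNum e0)). Qed.

Section closed_subspaces.
Context {R : realType} {V : lmodType R}.
(* [N] is only required to behave as a seminorm on the subspace [S], so that an
   integral which may diverge outside [S] can be used for it. *)
Variables (S : set V) (N : V -> R).
Hypothesis S_lin : forall a u v, S u -> S v -> S (a *: u + v).
Hypothesis N_ge0 : forall u, 0 <= N u.
Hypothesis N_homo : forall a u, S u -> N (a *: u) = `|a| * N u.
Hypothesis N_triangle : forall u v, S u -> S v -> N (u + v) <= N u + N v.

Definition subspace (W : set V) :=
  [/\ W 0, W `<=` S & forall a u v, W u -> W v -> W (a *: u + v)].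

(** This is closedness of [W] in a form that needs no quotient by the null
    space of [N]: a vector at distance zero from [W] differs from an element
    of [W] by a null vector. *)
Definition attained_or_far (W : set V) := forall g, S g ->
  (exists2 w, W w & N (g - w) = 0) \/
  (exists2 d, 0 < d & forall w, W w -> d <= N (g - w)).

Let SZ a u : S u -> S (a *: u).
Proof.
move=> Su; rewrite (_ : a *: u = (a - 1) *: u + u); first exact: S_lin.
by rewrite scalerBl scale1r subrK.
Qed.

Let SB u v : S u -> S v -> S (u - v).
Proof. by move=> Su Sv; rewrite addrC -scaleN1r; exact: S_lin. Qed.

Lemma attained_or_far0 : attained_or_far [set 0].
Proof.
move=> g Sg; have [Ng0|Ng0] := eqVneq (N g) 0.
  by left; exists 0; rewrite ?subr0.
right; exists (N g); first by rewrite lt_def Ng0 N_ge0.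
by move=> w ->; rewrite subr0.
Qed.

(** Adding one generator [f] preserves closedness. If [f] is at distance zero
    from [W], nothing changes up to null vectors. Otherwise the distance [d]
    from [f] to [W] controls the coefficient, $|c| d \le N(cf + w)$, so along
    a minimizing sequence the coefficients converge to some [cl], and the
    problem for [g] reduces to the closedness of [W] at [g - cl *: f]. *)
Lemma attained_or_farD (W : set V) (f : V) : subspace W -> S f ->
  attained_or_far W ->
  attained_or_far [set v | exists c, exists2 w, W w & v = c *: f + w].
Proof.
move=> [W0 WS W_lin] Sf closedW g Sg.
have swap (a b w : V) : g - (a + w) = g - (b + w) + (b - a).
  rewrite -addrA !opprD -[in RHS]addrA [- w + _]addrCA addKr.
  by rewrite addrC [- w - a]addrC [LHS]addrC.
have WN w : W w -> W (- w).
  by move=> Ww; rewrite -scaleN1r -[_ *: _]addr0; exact: W_lin.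
have WB w w' : W w -> W w' -> W (w - w').
  by move=> Ww Ww'; rewrite addrC -scaleN1r; exact: W_lin.
have [[w0 Ww0 fw0]|[d d0 fd]] := closedW f Sf.
  have [[w Ww gw]|[e e0 ge]] := closedW g Sg.
    by left; exists w => //; exists 0, w; rewrite // scale0r add0r.
  right; exists e => // _ [c [w Ww ->]].
  apply: le_trans (ge _ (W_lin c _ _ Ww0 Ww)) _.
  rewrite (swap (c *: w0) (c *: f)) -scalerBr.
  apply: (le_trans (N_triangle _ _ _ _)).
  - by apply: SB => //; apply: S_lin => //; exact: WS.
  - by apply: SZ; apply: SB => //; exact: WS.
  by rewrite N_homo ?fw0 ?mulr0 ?addr0//; apply: SB => //; exact: WS.
have coef_le c w : W w -> `|c| * d <= N (c *: f + w).
  move=> Ww; have [->|c0] := eqVneq c 0; first by rewrite normr0 mul0r.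
  have -> : c *: f + w = c *: (f - (- (c^-1 *: w))).
    by rewrite opprK scalerDr scalerA mulfV// scale1r.
  rewrite N_homo; last first.
    by apply: SB => //; apply: WS; apply: WN; rewrite -[_ *: _]addr0; exact: W_lin.
  rewrite ler_wpM2l// fd//; apply: WN; rewrite -[_ *: _]addr0; exact: W_lin.
have [?|far] := pselect (exists2 e, 0 < e &
  forall v, (exists c, exists2 w, W w & v = c *: f + w) -> e <= N (g - v)).
  by right.
left.
have /choice[cw cwP] : forall k : nat, exists cw : R * V,
    W cw.2 /\ N (g - (cw.1 *: f + cw.2)) < k.+1%:R^-1.
  move=> k; apply: contrapT => /forallNP nex; apply: far.
  exists k.+1%:R^-1; first by rewrite invr_gt0.
  move=> _ [c [w Ww ->]]; rewrite leNgt; apply/negP => lt_k.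
  by apply: (nex (c, w)).
pose c k := (cw k).1; pose w k := (cw k).2.
have Ww k : W (w k) by have [] := cwP k.
have Nk k : N (g - (c k *: f + w k)) < k.+1%:R^-1 by have [] := cwP k.
have Sk k : S (g - (c k *: f + w k)).
  by apply: SB => //; apply: S_lin => //; exact: WS.
have c_cvg : cvgn c.
  apply/cauchy_cvgP; apply: cauchy_exP => e e0.
  near \oo => K; exists (c K).
  suff : \forall k \near \oo, ball (c K) e (c k) by [].
  near=> k; rewrite /ball/=.
  have dist : `|c K - c k| * d <= k.+1%:R^-1 + K.+1%:R^-1.
    apply: le_trans (coef_le (c K - c k) (w K - w k) (WB _ _ (Ww K) (Ww k))) _.
    have -> : (c K - c k) *: f + (w K - w k) =
        (g - (c k *: f + w k)) + (- 1) *: (g - (c K *: f + w K)).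
      rewrite scaleN1r opprB [RHS]addrC subrKA opprD addrACA.
      by rewrite scalerBl.
    apply: le_trans (N_triangle _ _ (Sk k) (SZ _ _ (Sk K))) _.
    by rewrite N_homo// normrN1 mul1r lerD// ltW.
  have Ksmall : K.+1%:R^-1 < e * d / 2.
    by near: K; apply: near_natSinv_lt; rewrite divr_gt0// mulr_gt0.
  have ksmall : k.+1%:R^-1 < e * d / 2.
    by near: k; apply: near_natSinv_lt; rewrite divr_gt0// mulr_gt0.
  rewrite -(ltr_pM2r d0); apply: le_lt_trans dist _.
  by rewrite [ltRHS]splitr ltrD.
pose cl := limn c.
have [] := closedW (g - cl *: f).
- by apply: SB => //; exact: SZ.
- move=> [w' Ww' gw']; exists (cl *: f + w'); first by exists cl, w'.
  by rewrite opprD addrA.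
move=> [e e0 ge]; exfalso.
have e1 : 0 < e / 2 / (1 + N f) by rewrite !divr_gt0// ltr_pwDl.
near \oo => k.
have := ge _ (Ww k).
have -> : g - cl *: f - w k = (c k - cl) *: f + (g - (c k *: f + w k)).
  by rewrite -addrA -opprD (swap _ (c k *: f)) addrC scalerBl.
apply/negP; rewrite -ltNge.
apply: le_lt_trans (N_triangle _ _ (SZ _ _ Sf) (Sk k)) _.
rewrite N_homo//.
have ksmall : k.+1%:R^-1 < e / 2.
  by near: k; apply: near_natSinv_lt; rewrite divr_gt0.
suff : `|c k - cl| * N f <= e / 2.
  by move=> h; rewrite [ltRHS]splitr; exact: ler_ltD h (lt_trans (Nk k) ksmall).
have : `|c k - cl| <= e / 2 / (1 + N f).
  near: k; have /cvgrPdist_le /(_ _ e1) := c_cvg.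
  by apply: filterS => k; rewrite distrC.
move=> h; apply: le_trans (ler_wpM2r (N_ge0 f) h) _.
rewrite mulrAC ler_pdivrMr ?ltr_pwDl// ler_wpM2l//; first by rewrite ltW// divr_gt0.
by rewrite lerDr.
Unshelve. all: by end_near. Qed.

Lemma attained_or_far_span (I : eqType) (F : I -> V) (s : seq I) :
  uniq s -> S 0 -> (forall i, i \in s -> S (F i)) ->
  attained_or_far [set v | exists c : I -> R, v = \sum_(i <- s) c i *: F i].
Proof.
move=> us S0 SF.
suff [_ //] : subspace [set v | exists c : I -> R, v = \sum_(i <- s) c i *: F i] /\
  attained_or_far [set v | exists c : I -> R, v = \sum_(i <- s) c i *: F i].
elim: s us SF => [_ _|i s IHs /= /andP[nis us] SF].
  rewrite (_ : mkset _ = [set 0]); last first.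
    apply/seteqP; split=> [v [c ->]|v ->]; first by rewrite big_nil.
    by exists (fun=> 0); rewrite big_nil.
  split; last exact: attained_or_far0.
  split => //; first by move=> _ ->.
  by move=> a u v -> ->; rewrite scaler0 addr0.
have [|subs clos] := IHs us.
  by move=> j js; apply: SF; rewrite inE js orbT.
have Fi : S (F i) by apply: SF; rewrite mem_head.
have [W0 WS W_lin] := subs.
rewrite (_ : mkset _ = [set v | exists c, exists2 w,
    [set v | exists c : I -> R, v = \sum_(i <- s) c i *: F i] w &
    v = c *: F i + w]); last first.
  apply/seteqP; split=> [v [c ->]|v [a [w [c ->] ->]]].
    exists (c i), (\sum_(j <- s) c j *: F j); last by rewrite big_cons.
    by exists c.
  exists (fun j => if j == i then a else c j); rewrite big_cons eqxx; congr +%R.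
  rewrite !big_seq; apply: eq_bigr => j js; case: eqP => // ji.
  by rewrite ji (negbTE nis) in js.
split; last exact: attained_or_farD.
split.
- exists 0, 0 => //; by rewrite scale0r addr0.
- move=> _ [a [w Ww ->]]; apply: S_lin => //; exact: WS.
- move=> a _ _ [b [w Ww ->]] [b' [w' Ww' ->]].
  exists (a * b + b'), (a *: w + w'); first exact: W_lin.
  by rewrite scalerDr scalerA scalerDl addrACA.
Qed.

End closed_subspaces.

(** * Boxes and Koranyi balls *)

Section boxes.
Context {R : realType}.

Definition rVbox {m} (a : 'rV[R]_m) (r : R) : set 'rV[R]_m :=
  [set x | forall i, `|x ord0 i - a ord0 i| <= r].

Lemma rVboxE {m} (a : 'rV[R]_m) (r : R) :
  rVbox a r = [set x | forall i,
    ([set` `[a ord0 i - r, a ord0 i + r]] : set (measurableTypeR R)) (x ord0 i)].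
Proof.
by apply/seteqP; split=> x + i => /(_ i)/=; rewrite in_itv/= ler_distl.
Qed.

Lemma measurable_rVbox {m} (a : 'rV[R]_m) (r : R) : measurable (rVbox a r).
Proof.
rewrite (_ : rVbox a r = \bigcap_(i in [set: 'I_m])
    ((fun x : 'rV[R]_m => x ord0 i : measurableTypeR R) @^-1`
      [set` `[a ord0 i - r, a ord0 i + r]])); last first.
  rewrite rVboxE; by apply/seteqP; split => x Ax k; [move=> _|]; exact: Ax.
apply: fin_bigcap_measurable => // k _.
by rewrite -[X in measurable X]setTI; exact: measurable_coord.
Qed.

Lemma lebesgue_rVbox {m} (a : 'rV[R]_m) (r : R) : 0 <= r ->
  lebesgue_rV m (rVbox a r) = ((2 * r) ^+ m)%:E.
Proof.
move=> r0; rewrite rVboxE (lebesgue_rV_box (A := fun i =>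
  [set` `[a ord0 i - r, a ord0 i + r]] : set (measurableTypeR R))); last first.
  by move=> i; exact: measurable_itv.
under eq_bigr => i _.
  rewrite lebesgue_measure_itv/= lte_fin.
  rewrite (_ : (if _ then _ else _) = (2 * r)%:E); last first.
    case: ltP => [_|]; first by rewrite -EFinB; congr EFin; lra.
    by move=> h; congr EFin; lra.
  over.
by rewrite prodEFin prodr_const card_ord.
Qed.

Definition hbox {n} (a : 'rV[R]_(n + n)) (r : R) (I : set (measurableTypeR R)) :
  set (heis n) := rVbox a r `*` I.

Lemma measurable_hbox {n} (a : 'rV[R]_(n + n)) r I :
  measurable I -> measurable (hbox a r I).
Proof. by move=> mI; apply: measurableX => //; exact: measurable_rVbox. Qed.

Lemma haar_hbox {n} (a : 'rV[R]_(n + n)) r I : 0 <= r -> measurable I ->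
  haar n (hbox a r I) = (((2 * r) ^+ (n + n))%:E * lebesgue_measure I)%E.
Proof.
move=> r0 mI; rewrite -(lebesgue_rVbox a r r0).
apply: product_measure1E => //; exact: measurable_rVbox.
Qed.

Lemma measurable_hcoord {n} i :
  measurable_fun [set: heis n] (fun z : heis n => z.1 ord0 i : R).
Proof. exact: (measurableT_comp (measurable_coord i) measurable_fst). Qed.

(** The $t$-component of $z^{-1} \cdot (y, s)$ is $s$ minus this quantity. *)
Definition htwist {n} (z : heis n) (y : 'rV[R]_(n + n)) : R :=
  z.2 + (z.1 *m heisJ n *m y^T) ord0 ord0.

(** Without its fourth root, membership in a ball is a polynomial inequality,
    which settles measurability and is easy to estimate coordinatewise. *)
Lemma hballE {n} (z : heis n) (r : R) : 0 < r ->
  hball z r = [set w : heis n | (\sum_i (w.1 ord0 i - z.1 ord0 i) ^+ 2) ^+ 2 +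
                       (w.2 - htwist z w.1) ^+ 2 < r ^+ 4].
Proof.
move=> r0; apply/seteqP; split => w; rewrite /hball/= /koranyi/=.
all: rewrite (_ : euclid _ ^+ 4 = (\sum_i (w.1 ord0 i - z.1 ord0 i) ^+ 2) ^+ 2);
  last by rewrite (exprM _ 2 2) sqr_sqrtr ?sumr_ge0// => [|i _]; rewrite ?sqr_ge0//;
     congr (_ ^+ 2); apply: eq_bigr => i _; rewrite !mxE addrC.
all: rewrite (_ : - _ + _ + _ = w.2 - htwist z w.1);
  last by rewrite /htwist !mulNmx mxE opprD addrA [- z.2 + _]addrC.
all: set u := (X in X `^ _).
all: have u0 : 0 <= u by rewrite addr_ge0 ?sqr_ge0.
all: have r4 : r = (r ^+ 4) `^ 4^-1 by
  rewrite -powR_mulrn ?ltW// -powRrM mulfV// powRr1// ltW.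
- rewrite [X in _ < X]r4 => h; rewrite ltNge; apply/negP => h'.
  move: h; rewrite ltNge => /negP; apply.
  by apply: ge0_ler_powR => //; rewrite ?nnegrE ?exprn_ge0 ?ltW.
- move=> h; rewrite [ltRHS]r4.
  by apply: gt0_ltr_powR => //; rewrite ?nnegrE ?exprn_ge0 ?ltW.
Qed.

Lemma measurable_htwist {n} (z : heis n) :
  measurable_fun [set: heis n] (fun w : heis n => htwist z w.1).
Proof.
rewrite /htwist.
apply: measurable_funD => //.
under eq_fun do (rewrite mxE; under eq_bigr do rewrite [X in _ * X]mxE).
apply: measurable_sum => i; apply: measurable_funM => //.
exact: measurable_hcoord.
Qed.

Lemma measurable_hball {n} (z : heis n) (r : R) : 0 < r ->
  measurable (hball z r).
Proof.
move=> r0; rewrite hballE//.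
pose f (w : heis n) : R := (\sum_i (w.1 ord0 i - z.1 ord0 i) ^+ 2) ^+ 2 +
  ((w.2 : R) - htwist z w.1) ^+ 2.
rewrite (_ : mkset _ = f @^-1` `]-oo, (r ^+ 4)[); last first.
  by apply/seteqP; split => w; rewrite /= in_itv.
rewrite -[X in measurable X]setTI.
have mf : measurable_fun setT f; last exact: mf.
apply: measurable_funD.
  apply: measurable_funX; apply: measurable_sum => i.
  apply: measurable_funX; apply: measurable_funB => //.
  exact: measurable_hcoord.
apply: measurable_funX; apply: measurable_funB => //.
exact: measurable_htwist.
Qed.

(** Slicing replaces translation invariance of the Haar measure: over each [y]
    within [r] of the center the section of the ball lies in an interval of
    length $2 r^2$ about [htwist z y], and over the other [y] it is empty. *)
Lemma haar_hball_le {n} (z : heis n) (r : R) : 0 < r ->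
  (haar n (hball z r) <= ((2 * r) ^+ (n + n) * (2 * r ^+ 2))%:E)%E.
Proof.
move=> r0.
have mB := measurable_hball z _ r0.
have r2 : 0 <= 2 * r ^+ 2 by rewrite mulr_ge0// exprn_ge0// ltW.
have -> : haar n (hball z r) = (\int[lebesgue_rV (n + n)]_y
  (lebesgue_measure \o xsection (hball z r)) y)%E by [].
apply: (@le_trans _ _ (\int[lebesgue_rV (n + n)]_y
   ((2 * r ^+ 2)%:E * (\1_(rVbox z.1 r) y)%:E))%E); last first.
  rewrite ge0_integralZl//=; last first.
    by apply/measurable_EFinP; apply: measurable_indic; exact: measurable_rVbox.
  rewrite integral_indic//; last exact: measurable_rVbox.
  by rewrite setIT [X in (_ * X)%E](lebesgue_rVbox z.1 r (ltW r0)) -EFinM mulrC.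
apply: ge0_le_integral => //.
- exact: measurable_fun_xsection.
- apply: measurable_funeM; apply/measurable_EFinP; apply: measurable_indic.
  exact: measurable_rVbox.
move=> y _ /=.
have [yB|yB] := pselect (rVbox z.1 r y).
  rewrite indicE mem_set// mule1.
  apply: (@le_trans _ _ (lebesgue_measure (ball (htwist z y) (r ^+ 2)))); last first.
    by rewrite lebesgue_measure_ball ?exprn_ge0 ?(ltW r0)// mulr_natl.
  apply: le_measure; rewrite ?inE.
  - exact: measurable_xsection.
  - exact: measurable_ball.
  move=> s; rewrite /xsection/= inE hballE//= /ball/= distrC => h.
  have : (s - htwist z y) ^+ 2 < (r ^+ 2) ^+ 2.
    rewrite -exprM; apply: le_lt_trans h.
    by rewrite lerDr sqr_ge0.
  by rewrite -[X in X < _]real_normK ?num_real// ltr_sqr ?nnegrE ?exprn_ge0 ?(ltW r0).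
rewrite indicE memNset// mule0 (_ : xsection _ _ = set0) ?measure0//.
rewrite -subset0 => s; rewrite /xsection/= inE hballE//= => h; apply: yB => i.
rewrite -ler_sqr ?nnegrE ?(ltW r0)// real_normK ?num_real//.
have : (\sum_i (y ord0 i - z.1 ord0 i) ^+ 2) ^+ 2 < (r ^+ 2) ^+ 2.
  rewrite -exprM; apply: le_lt_trans h.
  by rewrite lerDl sqr_ge0.
rewrite ltr_sqr ?nnegrE ?exprn_ge0 ?(ltW r0) ?sumr_ge0// => [|j _]; rewrite ?sqr_ge0//.
move/ltW; apply: le_trans; rewrite (bigD1 i)//= lerDl sumr_ge0// => j _.
by rewrite sqr_ge0.
Qed.

End boxes.

(** * From mean to power-mean lower bounds *)

Section power_bounds.
Context {R : realType}.

(** Where $a > e$, the factor $(a/e)^{q-1}$ is at least [1]. With [e] free, this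
    does the work of the Hoelder inequality on a set of finite measure. *)
Lemma le_add_powR (a e q : R) : 0 <= a -> 0 < e -> 1 <= q ->
  a <= e + e `^ (1 - q) * a `^ q.
Proof.
move=> a0 e0 q1; have [ae|ea] := leP a e.
  by apply: (le_trans ae); rewrite lerDl mulr_ge0// powR_ge0.
have a_gt0 := lt_trans e0 ea.
suff : a <= e `^ (1 - q) * a `^ q by move=> h; apply: (le_trans h); rewrite lerDr ltW.
have aq : a `^ q = a * a `^ (q - 1).
  by rewrite -[X in X * _]powRr1 ?ltW// -powRD ?(gt_eqF a_gt0) ?implybT// addrC subrK.
rewrite aq mulrCA -[leLHS]mulr1 ler_wpM2l//.
rewrite -(opprB q 1) powRN ler_pdivlMl ?powR_gt0// mulr1.
by apply: ge0_ler_powR; rewrite ?nnegrE ?subr_ge0// ltW.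
Qed.

(** Integrate [le_add_powR] over [D], with [e] small enough that the term
    [e * M] uses up at most half of [delta]. The bound depends on [f] only
    through [delta], hence is uniform over a family of functions. *)
Lemma int_powR_ge d (T : measurableType d) (mu : {measure set T -> \bar R})
    (D : set T) (M delta q : R) (f : T -> R) :
  measurable D -> mu D = M%:E -> 0 < delta -> 1 <= q -> measurable_fun D f ->
  (delta%:E <= \int[mu]_(x in D) `|f x|%:E)%E ->
  (((delta / (2 * (1 + M))) `^ (q - 1) * (delta / 2))%:E <=
     \int[mu]_(x in D) (`|f x| `^ q)%:E)%E.
Proof.
move=> mD muD d0 q1 mf df.
have M0 : 0 <= M by rewrite -lee_fin -muD.
(* [1 + M] instead of [M] keeps [e] meaningful when [D] is negligible. *)
set e := delta / (2 * (1 + M)).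
have e0 : 0 < e by rewrite divr_gt0// mulr_gt0// ltr_pwDl.
have eM : e * M <= delta / 2.
  rewrite /e mulrAC ler_pdivrMr ?mulr_gt0 ?ltr_pwDl// mulrA divfK//.
  by rewrite ler_wpM2l ?(ltW d0)// lerDr.
have mq : measurable_fun D (fun x => (`|f x| `^ q)%:E).
  apply/measurable_EFinP; apply: (measurableT_comp (measurable_powR q)).
  exact: measurableT_comp.
have le1 : (\int[mu]_(x in D) `|f x|%:E <= (e * M)%:E +
     (e `^ (1 - q))%:E * \int[mu]_(x in D) (`|f x| `^ q)%:E)%E.
  rewrite -ge0_integralZl//; last by rewrite lee_fin powR_ge0.
  rewrite EFinM -muD -integral_cst// -ge0_integralD//; last 3 first.
    by move=> x _; rewrite lee_fin ltW.
    by move=> x _; rewrite -EFinM lee_fin mulr_ge0// powR_ge0.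
    by apply: measurable_funeM.
  apply: ge0_le_integral => //.
  - by apply/measurable_EFinP; exact: measurableT_comp.
  - by apply: emeasurable_funD => //; apply: measurable_funeM.
  - by move=> x _; rewrite -EFinM -EFinD lee_fin le_add_powR.
have : (0 <= \int[mu]_(x in D) (`|f x| `^ q)%:E)%E.
  by apply: integral_ge0 => x _; rewrite lee_fin powR_ge0.
move: le1; case: (\int[mu]_(x in D) (`|f x| `^ q)%:E)%E => [I| |] //=; last first.
  by move=> _ _; rewrite leey.
move=> le1 _; have := le_trans df le1.
rewrite -EFinM -EFinD !lee_fin => h.
have h2 : delta / 2 <= e `^ (1 - q) * I by lra.
by rewrite -ler_pdivlMl ?powR_gt0// -powRN opprB.
Qed.

End power_bounds.

(** * Distance to the polynomials of degree at most one *)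

Section affine.
Context {R : realType} {n : nat}.
Implicit Types f g : @heis R n -> R.

Definition haffine f := exists (a : R) (b : 'I_(n + n) -> R),
  forall z, f z = a + \sum_j b j * z.1 ord0 j.

Lemma haffineD f g : haffine f -> haffine g -> haffine (fun z => f z + g z).
Proof.
move=> [a [b fE]] [a' [b' gE]]; exists (a + a'), (fun j => b j + b' j) => z.
rewrite fE gE addrACA; congr (_ + _).
by rewrite -big_split; apply: eq_bigr => j _; rewrite mulrDl.
Qed.

Lemma haffineZ c f : haffine f -> haffine (fun z => c * f z).
Proof.
move=> [a [b fE]]; exists (c * a), (fun j => c * b j) => z.
by rewrite fE mulrDr mulr_sumr; congr (_ + _); apply: eq_bigr => j _; rewrite mulrA.
Qed.

(** The variable $t$ has homogeneous degree [2], so in degree at most [1] only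
    the constant and the coordinates of $x$ remain. *)
Lemma hmonomial_affine (k : nat) (I : multi_index n k) :
  (hdeg I <= 1)%N -> haffine (fun z => hmonomial I z : R).
Proof.
case: I => b t; rewrite /hdeg/= => degI.
have t0 : (t : nat) = 0%N by lia.
have [/forallP b0|/forallPn/=[j bj]] := boolP [forall j, (b j : nat) == 0%N].
  exists 1, (fun=> 0) => z; rewrite /hmonomial/= t0 expr0 mulr1.
  rewrite big1 => [|i _]; last by rewrite (eqP (b0 i)) expr0.
  by rewrite big1 ?addr0// => i _; rewrite mul0r.
move: degI; rewrite (bigD1 j)//= t0 muln0 addn0 => degI.
have bj1 : (b j : nat) = 1%N.
  by apply/eqP; rewrite eqn_leq lt0n bj (leq_trans (leq_addr _ _) degI).
have bi i : i != j -> (b i : nat) = 0%N.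
  move: degI; rewrite bj1 add1n ltnS leqn0 sum_nat_eq0 => /forallP/(_ i) + ij.
  by rewrite ij => /eqP.
exists 0, (fun i => (i == j)%:R) => z; rewrite /hmonomial/= t0 expr0 mulr1 add0r.
rewrite (bigD1 j)//= bj1 expr1 [in RHS](bigD1 j)//= eqxx mul1r.
rewrite big1 ?mulr1 => [|i ij]; last by rewrite bi// expr0.
by rewrite big1 ?addr0// => i ij; rewrite (negbTE ij) mul0r.
Qed.

(** The real form of [hpoly 1]. It is indexed by coefficients rather than
    stated as a set so that taking real or imaginary parts is an operation on
    coefficients. *)
Definition hpolyR (c : multi_index n 1 -> R) (z : heis n) : R :=
  \sum_(I | (hdeg I <= 1)%N) c I * hmonomial I z.

Lemma hpolyR_affine c : haffine (hpolyR c).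
Proof.
suff /(_ (index_enum _)) : forall s : seq (multi_index n 1),
  haffine (fun z => \sum_(I <- s | (hdeg I <= 1)%N) c I * hmonomial I z) by [].
elim=> [|I s IHs].
  exists 0, (fun=> 0) => z; rewrite big_nil big1 ?addr0// => j _.
  by rewrite mul0r.
have [degI|/negbTE degI] := boolP (hdeg I <= 1)%N; last first.
  by case: IHs => a [b E]; exists a, b => z; rewrite big_cons degI.
have [a [b E]] := haffineD _ _ (haffineZ (c I) _ (hmonomial_affine _ I degI)) IHs.
by exists a, b => z; rewrite big_cons degI.
Qed.

Lemma measurable_haffine f : haffine f -> measurable_fun setT f.
Proof.
move=> [a [b fE]]; rewrite (_ : f = fun z => a + \sum_j b j * z.1 ord0 j); last exact/funext.
apply: measurable_funD => //; apply: measurable_sum => j.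
by apply: measurable_funM => //; exact: measurable_hcoord.
Qed.

(** Radius [m.+1] makes every cube contain the unit one, where the coefficients
    of an affine function can be read off. *)
Definition hcube (m : nat) : set (@heis R n) :=
  hbox 0 m.+1%:R [set` `[- m.+1%:R, m.+1%:R]].

Lemma measurable_hcube m : measurable (hcube m).
Proof. by apply: measurable_hbox; exact: measurable_itv. Qed.

Lemma hcubeP m z : hcube m z ->
  (forall i, `|z.1 ord0 i| <= m.+1%:R) /\ `|z.2 : R| <= m.+1%:R.
Proof.
move=> [z1 z2]; split=> [i|]; first by have := z1 i; rewrite mxE subr0.
by move: z2; rewrite /= in_itv/= ler_norml.
Qed.

Lemma hcubeI m (z : @heis R n) : (forall i, `|z.1 ord0 i| <= m.+1%:R) ->
  `|z.2 : R| <= m.+1%:R -> hcube m z.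
Proof.
move=> z1 z2; split=> [i|]; first by rewrite mxE subr0.
by rewrite /= in_itv/= -ler_norml.
Qed.

Lemma haar_hcube m :
  haar n (hcube m) = ((2 * m.+1%:R) ^+ (n + n) * (2 * m.+1%:R))%:E.
Proof.
have mI : measurable ([set` `[- m.+1%:R, m.+1%:R]] : set (measurableTypeR R)).
  exact: measurable_itv.
rewrite (haar_hbox 0 _ _ (ler0n R m.+1) mI).
rewrite lebesgue_measure_itv/= lte_fin ifT; last by rewrite gtrN.
by rewrite -EFinB opprK -EFinM mulr2n mulrDl mul1r.
Qed.

Lemma compact_hcube m : compact (hcube m).
Proof.
apply: compact_setX; last exact: segment_compact.
rewrite rVboxE.
apply: (rV_compact (A := fun i : 'I_(n + n) =>
  [set` `[(0 : 'rV[R]_(n + n)) ord0 i - m.+1%:R, (0 : 'rV[R]_(n + n)) ord0 i + m.+1%:R]])) => i.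
exact: segment_compact.
Qed.

Lemma hcube_cover (z : @heis R n) : exists m, hcube m z.
Proof.
have [m zm] : exists m : nat, \sum_i `|z.1 ord0 i| + `|z.2 : R| <= m.+1%:R.
  exists (Num.truncn (\sum_i `|z.1 ord0 i| + `|z.2 : R|)).
  rewrite ltW//; have := truncnS_gt (\sum_i `|z.1 ord0 i| + `|z.2 : R|); exact.
exists m; apply: hcubeI => [i|]; apply: le_trans zm.
  by rewrite (bigD1 i)//= -addrA lerDl addr_ge0// sumr_ge0.
by rewrite lerDr sumr_ge0.
Qed.

Lemma haffine_integrable f m : haffine f ->
  (haar n).-integrable (hcube m) (EFin \o f).
Proof.
move=> af; apply: measurable_bounded_integrable.
- exact: measurable_hcube.
- by rewrite [X in (X < _)%E]haar_hcube ltry.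
- by apply: measurable_funTS; exact: measurable_haffine.
case: af => a [b fE].
exists (`|a| + \sum_j `|b j| * m.+1%:R); split; first exact: num_real.
move=> M ltM z /hcubeP[z1 _] /=; apply: le_trans (ltW ltM); rewrite fE.
apply: (le_trans (ler_normD _ _)); rewrite lerD2l.
apply: (le_trans (ler_norm_sum _ _ _)); apply: ler_sum => j _.
by rewrite normrM ler_wpM2l.
Qed.

(** If [f] were nonzero at a point of the cube of radius one half, then, being
    Lipschitz, it would be nonzero on a box of positive measure around that
    point and inside [hcube m]. So [f] vanishes at the origin and at half of
    each basis vector, and these values determine its coefficients. *)
Lemma haffine_ae0 f m : haffine f ->
  {ae haar n, forall z, hcube m z -> f z = 0} -> forall z, f z = 0.
Proof.
move=> [a [b fE]] [N [mN N0 subN]].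
have zero (x : 'rV[R]_(n + n)) : (forall i, `|x ord0 i| <= 2^-1) ->
    a + \sum_j b j * x ord0 j = 0.
  move=> x1; apply: contrapT => /eqP fx0.
  set v := a + _ in fx0.
  pose B := \sum_j `|b j|.
  have B0 : 0 <= B by rewrite sumr_ge0.
  pose e := Num.min 2^-1 (`|v| / (2 * (1 + B))).
  have v0 : 0 < `|v| by rewrite normr_gt0.
  have e0 : 0 < e.
    by rewrite lt_min invr_gt0 ltr0n/= divr_gt0// mulr_gt0// ltr_pwDl.
  have Be : B * e < `|v|.
    apply: (@le_lt_trans _ _ (B * (`|v| / (2 * (1 + B))))).
      by rewrite ler_wpM2l// ge_min lexx orbT.
    rewrite mulrCA gtr_pMr// ltr_pdivrMr ?mul1r ?mulr_gt0 ?ltr_pwDl//.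
    by lra.
  pose X := @hbox R n x e [set` `[0, 1]].
  have mX : measurable X by apply: measurable_hbox; exact: measurable_itv.
  have XN : X `<=` N.
    move=> w [w1 w2]; apply: subN => /=; apply/not_implyP; split.
      apply: hcubeI => [i|].
        have -> : w.1 ord0 i = (w.1 ord0 i - x ord0 i) + x ord0 i by rewrite subrK.
        apply: (le_trans (ler_normD _ _)).
        apply: (@le_trans _ _ (2^-1 + 2^-1)).
          apply: lerD => //; apply: (le_trans (w1 i)).
          by rewrite ge_min lexx.
        by rewrite -[X in X + _]mul1r -[X in _ + X]mul1r -splitr ler1n.
      move: w2; rewrite /= in_itv/= => /andP[w20 w21].
      by rewrite ger0_norm// (le_trans w21)// ler1n.
    rewrite fE => fw0; move: Be; rewrite ltNge => /negP; apply.
    rewrite -[leLHS]normrN -[- v]addr0 -fw0 /v opprD addrACA addNr add0r -sumrN -big_split/=.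
    apply: (le_trans (ler_norm_sum _ _ _)); rewrite mulr_suml; apply: ler_sum => j _.
    by rewrite addrC -mulrBr normrM ler_wpM2l//; exact: w1.
  have : haar n X = 0 by apply: subset_measure0 N0.
  have mI : measurable ([set` `[0, 1]] : set (measurableTypeR R)).
    exact: measurable_itv.
  rewrite (haar_hbox x _ _ (ltW e0) mI).
  rewrite lebesgue_measure_itv/= lte_fin ltr01 oppr0 adde0 mule1 => /eqP.
  by rewrite eqe expf_eq0 mulf_eq0 (gt_eqF e0) pnatr_eq0/= andbF.
have a0 : a = 0.
  have /= := zero 0; rewrite big1 ?addr0; last by move=> j _; rewrite mxE mulr0.
  by apply => i; rewrite mxE normr0 invr_ge0.
have b0 j : b j = 0.
  have := zero (\row_i ((i == j)%:R / 2)); rewrite a0 add0r (bigD1 j)//= mxE eqxx.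
  rewrite big1 ?addr0 => [h|i ij]; last by rewrite mxE (negbTE ij) mul0r mulr0.
  have /eqP : b j * (1%:R / 2) = 0.
    apply: h => i; rewrite mxE; case: (i == j).
      by rewrite mul1r ger0_norm ?invr_ge0.
    by rewrite mul0r normr0 invr_ge0.
  by rewrite mulf_eq0 mul1r invr_eq0 pnatr_eq0 orbF => /eqP.
by move=> z; rewrite fE a0 add0r big1// => j _; rewrite b0 mul0r.
Qed.

(** Closedness of the span of the monomials, for the $L^1$ seminorm of one
    cube. *)
Lemma hcube_ae_or_far (u : heis n -> R) m :
  (haar n).-integrable (hcube m) (EFin \o u) ->
  (exists c, {ae haar n, forall z, hcube m z -> u z = hpolyR c z}) \/
  (exists2 d : R, 0 < d & forall c,
    (d%:E <= \int[haar n]_(z in hcube m) `|u z - hpolyR c z|%:E)%E).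
Proof.
move=> iu.
pose S := [set f : heis n -> R | (haar n).-integrable (hcube m) (EFin \o f)].
pose N (f : heis n -> R) := \int[haar n]_(z in hcube m) `|f z|.
have mD := measurable_hcube m.
have iabs f : S f -> (haar n).-integrable (hcube m) (EFin \o (fun z => `|f z|)).
  by move=> If; exact: (integrable_norm (f := f)).
have Slin (a : R) (f g : heis n -> R) : S f -> S g -> S (a *: f + g).
  move=> If Ig; rewrite /S/=.
  have -> : EFin \o (a *: f + g) = (fun z => (a%:E * (EFin \o f) z)%E) \+ (EFin \o g).
    by apply/funext.
  by apply: integrableD => //; exact: integrableZl.
have NE f : S f -> (N f)%:E = (\int[haar n]_(z in hcube m) `|f z|%:E)%E.
  move=> If; rewrite /N /Rintegral fineK//.
  exact: (integrable_fin_num (f := EFin \o (fun z => `|f z|)) mD (iabs _ If)).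
have N0 f : 0 <= N f by apply: Rintegral_ge0.
have NZ (a : R) (f : heis n -> R) : S f -> N (a *: f) = `|a| * N f.
  move=> If; rewrite /N -RintegralZl//; last exact: iabs.
  by apply: eq_Rintegral => z _; rewrite /= normrM.
have ND (f g : heis n -> R) : S f -> S g -> N (f + g) <= N f + N g.
  move=> If Ig; rewrite /N -RintegralD//; [|exact: iabs|exact: iabs].
  apply: le_Rintegral => //.
  - by apply: iabs; rewrite -[f]scale1r; exact: Slin.
  - by apply: (integrableD mD (iabs _ If) (iabs _ Ig)).
  - by move=> z _; exact: ler_normD.
pose s := [seq I : multi_index n 1 <- index_enum _ | (hdeg I <= 1)%N].
have sumE c : \sum_(I <- s) c I *: (fun z => hmonomial I z : R) = hpolyR c.
  apply/funext => z; rewrite /hpolyR -[RHS]big_filter -/s.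
  elim: (s) => [|I s' IHs]; first by rewrite !big_nil.
  by rewrite !big_cons -IHs.
have us : uniq s by rewrite filter_uniq// index_enum_uniq.
have S0 : S 0 by exact: (@integrable0 _ _ _ (haar n) (hcube m)).
have SF I : I \in s -> S (fun z => hmonomial I z).
  by rewrite mem_filter => /andP[degI _]; apply: haffine_integrable; exact: hmonomial_affine.
have Sp c : S (hpolyR c) by apply: haffine_integrable; exact: hpolyR_affine.
have SB c : S (u - hpolyR c).
  rewrite (_ : u - _ = -1 *: hpolyR c + u); first exact: Slin.
  by rewrite scaleN1r addrC.
have [[_ [c ->]]|[d d0 far]] := attained_or_far_span S N Slin N0 NZ ND _
  (fun (I : multi_index n 1) z => hmonomial I z) s us S0 SF u iu.
  rewrite sumE => Nu0; left; exists c.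
  have /ae_eq_integral_abs : (\int[haar n]_(z in hcube m) `|(EFin \o (u - hpolyR c)%R) z|)%E = 0%E.
    by rewrite -[RHS]/(0%:E) -Nu0 NE.
  move=> /(_ mD) h; have := h (measurable_int _ (SB c)).
  by apply: filterS => z + Dz => /(_ Dz)/= [] /eqP; rewrite subr_eq0 => /eqP.
right; exists d => // c; rewrite -(NE _ (SB c)) lee_fin; apply: far.
by exists c; rewrite sumE.
Qed.

(** Local solutions glue: if [u] agrees with a polynomial on each cube, all
    these polynomials agree with the one of the smallest cube. *)
Lemma ae_or_far (u : heis n -> R) :
  (forall m, (haar n).-integrable (hcube m) (EFin \o u)) ->
  (exists c, {ae haar n, forall z, u z = hpolyR c z}) \/
  (exists m, exists2 d : R, 0 < d & forall c,
    (d%:E <= \int[haar n]_(z in hcube m) `|u z - hpolyR c z|%:E)%E).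
Proof.
move=> iu; have [|nfar] := pselect (exists m, exists2 d : R, 0 < d & forall c,
  (d%:E <= \int[haar n]_(z in hcube m) `|u z - hpolyR c z|%:E)%E); [by right|left].
have /choice[c uc] : forall m, exists c,
    {ae haar n, forall z, hcube m z -> u z = hpolyR c z}.
  move=> m; have [//|far] := hcube_ae_or_far u m (iu m).
  by exfalso; apply: nfar; exists m.
have same m z : hpolyR (c m) z = hpolyR (c 0%N) z.
  apply/eqP; rewrite -subr_eq0 -mulN1r; apply/eqP; move: z.
  apply: (@haffine_ae0 _ 0%N).
    by apply: haffineD; [|apply: haffineZ]; exact: hpolyR_affine.
  apply: filterS2 (uc 0%N) (uc m) => z u0 um Dz.
  rewrite -u0// -um ?mulN1r ?subrr//.
  have [z1 z2] := hcubeP _ _ Dz.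
  by apply: hcubeI => [i|]; [apply: le_trans (z1 i) _|apply: le_trans z2 _];
    rewrite ler_nat.
exists (c 0%N).
have := ae_foralln uc; apply: filterS => z h.
by have [m /h ->] := hcube_cover z.
Qed.

End affine.

(** * Complex-valued representatives *)

Section parts.
Context {R : realType}.

(** The two parts satisfy the same identities and estimates; the boolean lets
    them share every proof. *)
Definition part (b : bool) (x : R[i]) : R :=
  if b then complex.Re x else complex.Im x.

Lemma partD b x y : part b (x + y) = part b x + part b y.
Proof. by case: b; case: x => ? ?; case: y. Qed.

Lemma part_sum b (I : Type) (s : seq I) (P : pred I) (F : I -> R[i]) :
  part b (\sum_(i <- s | P i) F i) = \sum_(i <- s | P i) part b (F i).
Proof.
elim: s => [|i s IHs]; first by rewrite !big_nil; case: b.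
by rewrite !big_cons; case: ifP; rewrite ?partD IHs.
Qed.

Lemma partMr b x (r : R) : part b (x * r%:C%C) = part b x * r.
Proof. by case: b; case: x => ? ?; rewrite /= mulr0 ?subr0 ?add0r. Qed.

Lemma part_eq x y : (forall b, part b x = part b y) -> x = y.
Proof.
move=> h; have /= := h true; have /= := h false.
by case: x {h} => ? ?; case: y => ? ? /= -> ->.
Qed.

Lemma norm_part_le b x : `|part b x| <= Normc.normc x.
Proof.
case: x => u v; rewrite /Normc.normc -sqrtr_sqr ler_wsqrtr//.
by case: b; rewrite /= ?lerDl ?lerDr sqr_ge0.
Qed.

Context {n : nat}.
Implicit Types g h : @heis R n -> R[i].

Lemma measurable_part b q h : Lq_loc q h ->
  measurable_fun setT (fun z => part b (h z)).
Proof. by case: b => -[]. Qed.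

Lemma measurable_normc q h : Lq_loc q h ->
  measurable_fun setT (fun z => Normc.normc (h z)).
Proof.
move=> [mRe mIm _].
rewrite (_ : (fun z => _) = (fun z => (complex.Re (h z) ^+ 2 + complex.Im (h z) ^+ 2) `^ 2^-1)).
  apply: (measurableT_comp (measurable_powR 2^-1)).
  by apply: measurable_funD; apply: measurable_funX.
by apply/funext => z; rewrite powR12_sqrt ?addr_ge0 ?sqr_ge0//; case: (h z).
Qed.

Lemma measurable_normc_powR q h : Lq_loc q h ->
  measurable_fun setT (fun z => (Normc.normc (h z) `^ q)%:E).
Proof.
move=> Lh; apply/measurable_EFinP; apply: (measurableT_comp (measurable_powR q)).
exact: measurable_normc Lh.
Qed.

Lemma Lq_loc_integrable b q h m : 1 <= q -> Lq_loc q h ->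
  (haar n).-integrable (hcube m) (EFin \o (fun z => part b (h z))).
Proof.
move=> q1 Lh; have mD := @measurable_hcube R n m.
have [_ _ /(_ _ (compact_hcube m)) foo] := Lh.
have mq := measurable_funTS (D := hcube m) (measurable_normc_powR _ _ Lh).
apply: (@le_integrable _ _ _ _ _ mD _
   (EFin \o (fun z : heis n => 1 + Normc.normc (h z) `^ q))).
- by apply/measurable_EFinP; apply: measurable_funTS; exact: measurable_part Lh.
- move=> z _; rewrite /= lee_fin (ger0_norm (addr_ge0 _ (powR_ge0 _ _)))//.
  apply: le_trans (norm_part_le b (h z)) _.
  have n0 : 0 <= Normc.normc (h z) by apply: le_trans (norm_part_le b (h z)).
  by have := le_add_powR (Normc.normc (h z)) 1 q n0 ltr01 q1; rewrite powR1 mul1r.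
have -> : EFin \o (fun z : heis n => 1 + Normc.normc (h z) `^ q) =
    (EFin \o cst 1) \+ (fun z : heis n => (Normc.normc (h z) `^ q)%:E) by apply/funext.
apply: integrableD => //.
  apply: (haffine_integrable (cst 1)); exists 1, (fun=> 0) => z.
  by rewrite big1 ?addr0// => j _; rewrite mul0r.
apply/integrableP; split => //.
under eq_integral => z _ do rewrite gee0_abs ?lee_fin ?powR_ge0//.
exact: foo.
Qed.

Lemma part_hpoly b (P : heis n -> R[i]) : hpoly 1 P ->
  exists c, forall z, part b (P z) = hpolyR c z.
Proof.
move=> [c ->]; exists (fun I => part b (c I)) => z.
by rewrite part_sum /hpolyR; apply: eq_bigr => I _; rewrite partMr.
Qed.

(** If [g] is not a polynomial then neither is one of its two parts [u]. For
    every representative [h] of the class, the same part of [h] is [u] plus a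
    real polynomial, so it is bounded below in $L^1$ of some cube by the
    distance from [u] to the polynomials, and $|h|$ dominates it. *)
Lemma coset1_zero_or_far q g : 1 < q -> Lq_loc q g ->
  (exists2 P, hpoly 1 P & {ae haar n, forall z, g z = P z}) \/
  (exists m, exists2 kappa : R, 0 < kappa & forall h, coset1 q g h ->
     (kappa%:E <= int_powq q (hcube m) h)%E).
Proof.
move=> /ltW q1 Lg.
have farP b m (d : R) : 0 < d -> (forall c,
    (d%:E <= \int[haar n]_(z in hcube m) `|part b (g z) - hpolyR c z|%:E)%E) ->
    exists m, exists2 kappa : R, 0 < kappa & forall h, coset1 q g h ->
     (kappa%:E <= int_powq q (hcube m) h)%E.
  move=> d0 far; exists m.
  have mD := @measurable_hcube R n m.
  set M := (2 * m.+1%:R) ^+ (n + n) * (2 * m.+1%:R) : R.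
  have M0 : 0 <= M by rewrite mulr_ge0 ?exprn_ge0 ?mulr_ge0.
  exists ((d / (2 * (1 + M))) `^ (q - 1) * (d / 2)).
    by rewrite mulr_gt0 ?powR_gt0 ?divr_gt0 ?mulr_gt0 ?ltr_pwDl.
  move=> h [Lh [P hP hE]].
  have [c cE] := part_hpoly b _ hP.
  have mh := measurable_funTS (D := hcube m) (measurable_part b _ _ Lh).
  have mg := measurable_funTS (D := hcube m) (measurable_part b _ _ Lg).
  have mq := measurable_funTS (D := hcube m) (measurable_normc_powR _ _ Lh).
  apply: (@le_trans _ _ (\int[haar n]_(z in hcube m) (`|part b (h z)| `^ q)%:E)%E).
    apply: int_powR_ge => //; first exact: haar_hcube.
    (* The sign: [far] bounds [u - P], whereas the part of [h] is [u + P]. *)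
    apply: le_trans (far (fun I => - c I)) _.
    rewrite le_eqVlt; apply/orP; left; apply/eqP.
    apply: ae_eq_integral => //.
    - apply/measurable_EFinP; apply: measurableT_comp => //.
      apply: measurable_funB => //; apply: measurable_funTS.
      apply: measurable_haffine; exact: hpolyR_affine.
    - by apply/measurable_EFinP; exact: measurableT_comp.
    apply: filterS hE => z -> _; rewrite partD cE; congr (`| _ + _ |%:E).
    by rewrite /hpolyR -sumrN; apply: eq_bigr => I _; rewrite mulNr opprK.
  apply: ge0_le_integral => //.
  - apply/measurable_EFinP; apply: (measurableT_comp (measurable_powR q)).
    exact: measurableT_comp.
  - move=> z _; rewrite lee_fin; apply: ge0_ler_powR.
    + exact: le_trans ler01 q1.
    + by rewrite nnegrE.
    + by rewrite nnegrE; apply: le_trans (norm_part_le b (h z)).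
    + exact: norm_part_le.
have [[cr crE]|[m [d d0 far]]] :=
  ae_or_far (fun z => part true (g z)) (fun m => Lq_loc_integrable true q g m q1 Lg);
  last by right; exact: farP far.
have [[ci ciE]|[m [d d0 far]]] :=
  ae_or_far (fun z => part false (g z)) (fun m => Lq_loc_integrable false q g m q1 Lg);
  last by right; exact: farP far.
left; exists (fun z => \sum_(I | (hdeg I <= 1)%N) (Complex (cr I) (ci I)) * (hmonomial I z)%:C%C).
  by exists (fun I => Complex (cr I) (ci I)).
apply: filterS2 crE ciE => z rE iE; apply: part_eq => b.
rewrite part_sum; case: b; rewrite ?rE ?iE /hpolyR; apply: eq_bigr => I _;
  by rewrite partMr.
Qed.

End parts.

(** * Lower bounds for the maximal function at infinity *)

Section lower_bound.
Context {R : realType} {n : nat}.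
Implicit Types g h : @heis R n -> R[i].

Lemma htwist_le (z : @heis R n) (y : 'rV[R]_(n + n)) (X a : R) :
  0 <= X -> (forall i, `|z.1 ord0 i| <= X) -> (forall i, `|y ord0 i| <= a) ->
  `|htwist z y - z.2| <= X * a * \sum_i \sum_j `|@heisJ R n j i|.
Proof.
move=> X0 zX ya; rewrite /htwist addrC addKr mxE mulr_sumr.
apply: (le_trans (ler_norm_sum _ _ _)); apply: ler_sum => i _.
rewrite !mxE mulr_suml mulr_sumr.
apply: (le_trans (ler_norm_sum _ _ _)); apply: ler_sum => j _.
rewrite !normrM [X in _ <= X]mulrAC.
by apply: ler_pM => //; rewrite ?mulr_ge0// ler_wpM2r.
Qed.

(** For [w] in the cube and [z] of homogeneous size [X], the components of
    $z^{-1} \cdot w$ are $O(X)$ and $O(X^2)$: in the second one the twist is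
    bilinear, hence $O(X)$ for bounded [w]. *)
Lemma hcube_sub_hball m : exists2 M : R, 0 < M & forall (z : @heis R n) (X : R),
  1 <= X -> (forall i, `|z.1 ord0 i| <= X) -> `|z.2 : R| <= 4 * X ^+ 2 ->
  hcube m `<=` hball z (M * X).
Proof.
set a : R := m.+1%:R.
have a1 : 1 <= a by rewrite ler1n.
set CJ := \sum_i \sum_j `|@heisJ R n j i|.
have CJ0 : 0 <= CJ by rewrite sumr_ge0// => i _; rewrite sumr_ge0.
pose A1 : R := \sum_(i < n + n) (2 * a) ^+ 2.
pose A2 : R := a + 4 + a * CJ.
have A10 : 0 <= A1 by rewrite sumr_ge0// => i _; rewrite sqr_ge0.
have A20 : 0 <= A2 by rewrite !addr_ge0 ?mulr_ge0// (le_trans ler01).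
pose A := A1 ^+ 2 + A2 ^+ 2.
have A0 : 0 <= A by rewrite addr_ge0 ?sqr_ge0.
(* $A < (1 + A)^4$ spares a fourth root. *)
exists (1 + A); first by rewrite ltr_pwDl.
move=> z X X1 zX tX w /hcubeP[]; rewrite -/a => wa sa.
have X0 : 0 <= X by exact: le_trans X1.
have X21 : 1 <= X ^+ 2 by rewrite exprn_ege1.
rewrite hballE/=; last by rewrite mulr_gt0 ?ltr_pwDl// (lt_le_trans ltr01).
have aX0 : 0 <= 2 * a * X by rewrite !mulr_ge0// (le_trans ler01).
have bound1 : \sum_i (w.1 ord0 i - z.1 ord0 i) ^+ 2 <= A1 * X ^+ 2.
  rewrite /A1 mulr_suml; apply: ler_sum => i _.
  rewrite -exprMn -[leLHS]real_normK ?num_real// lerXn2r ?nnegrE//.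
  apply: (le_trans (ler_normB _ _)).
  apply: le_trans (lerD (wa i) (zX i)) _; nra.
have bound2 : `|(w.2 : R) - htwist z w.1| <= A2 * X ^+ 2.
  have -> : (w.2 : R) - htwist z w.1 = w.2 - z.2 - (htwist z w.1 - z.2).
    by rewrite opprB addrA subrK.
  apply: (le_trans (ler_normB _ _)).
  apply: le_trans (lerD (ler_normB _ _) (htwist_le _ _ _ _ X0 zX wa)) _.
  rewrite -/CJ /A2 mulrDl (mulrDl a 4).
  apply: lerD; last first.
    rewrite -mulrA mulrC ler_wpM2l ?mulr_ge0 ?(le_trans ler01 a1)//.
    by rewrite expr2 ler_peMr.
  apply: lerD => //; apply: (le_trans sa); rewrite ler_peMr// (le_trans ler01)//.
apply: (@le_lt_trans _ _ (A * X ^+ 4)).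
  rewrite /A mulrDl (exprM X 2 2) -!exprMn; apply: lerD.
    rewrite lerXn2r ?nnegrE ?(mulr_ge0 A10) ?exprn_ge0//.
    by rewrite sumr_ge0// => i _; rewrite sqr_ge0.
  rewrite -[leLHS]real_normK ?num_real// lerXn2r ?nnegrE//.
  by rewrite (mulr_ge0 A20)// exprn_ge0.
rewrite exprMn ltr_pM2r ?exprn_gt0 ?(lt_le_trans ltr01)//.
apply: (@lt_le_trans _ _ (1 + A)); first by rewrite ltrDr.
by rewrite ler_eXnr// lerDl.
Qed.

(** The single radius [r] in the supremum already gives this bound. *)
Lemma eta2_ge q h (z : @heis R n) (r kappa : R) (D : set (heis n)) :
  0 < q -> 0 < r -> 0 <= kappa -> Lq_loc q h -> measurable D ->
  D `<=` hball z r -> (kappa%:E <= int_powq q D h)%E ->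
  ((r ^- 2 * (kappa / ((2 * r) ^+ (n + n) * (2 * r ^+ 2))) `^ q^-1)%:E <= eta2 q h z)%E.
Proof.
move=> q0 r0 k0 Lh mD Dr kD.
have vol0 : 0 < (2 * r) ^+ (n + n) * (2 * r ^+ 2).
  by rewrite mulr_gt0 ?exprn_gt0 ?mulr_gt0 ?exprn_gt0.
apply: (@le_trans _ _ ((r ^- 2)%:E * qmean q (hball z r) h)%E); last first.
  by apply: ereal_sup_ubound; exists r.
rewrite EFinM; apply: lee_wpmul2l; first by rewrite lee_fin invr_ge0 exprn_ge0 ?ltW.
rewrite /qmean -poweR_EFin.
have inv0 : (0 <= (haar n (hball z r))^-1)%E by rewrite inve_ge0.
have kB : (kappa%:E <= int_powq q (hball z r) h)%E.
  apply: (le_trans kD); apply: ge0_subset_integral => //.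
  - exact: measurable_hball.
  - exact: measurable_funTS (measurable_normc_powR _ _ Lh).
  by move=> w _; rewrite lee_fin powR_ge0.
apply: gt0_ler_poweR.
- by rewrite invr_ge0 ltW.
- by rewrite in_itv/= leey andbT lee_fin divr_ge0 ?(ltW vol0).
- by rewrite in_itv/= leey andbT mule_ge0// (le_trans _ kB).
rewrite mulrC EFinM; apply: lee_pmul => //.
  by rewrite lee_fin invr_ge0 ltW.
have -> : (((2 * r) ^+ (n + n) * (2 * r ^+ 2))^-1%:E =
   (((2 * r) ^+ (n + n) * (2 * r ^+ 2))%:E)^-1)%E by rewrite inver gt_eqF.
rewrite lee_pV2 ?inE//; first exact: haar_hball_le.
by rewrite lee_fin ltW.
Qed.

(** These dyadic pieces are products, unlike the Koranyi annuli, and the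
    time intervals alone make them disjoint. *)
Definition shell (k : nat) : set (@heis R n) :=
  hbox 0 (2 ^+ k) [set` `](4 ^+ k), (4 ^+ k.+1)]].

Lemma measurable_shell k : measurable (shell k).
Proof. by apply: measurable_hbox; exact: measurable_itv. Qed.

Lemma haar_shell k : (((2 ^+ k : R) `^ hdim n)%:E <= haar n (shell k))%E.
Proof.
have mI : measurable ([set` `](4 ^+ k), (4 ^+ k.+1)]] : set (measurableTypeR R)).
  exact: measurable_itv.
have X0 : 0 <= 2 ^+ k :> R by rewrite exprn_ge0.
have E4 : 4 ^+ k = (2 ^+ k) ^+ 2 :> R.
  by rewrite -exprM mulnC exprM; congr (_ ^+ _); rewrite expr2; lra.
rewrite (haar_hbox 0 _ _ X0 mI) lebesgue_measure_itv/= lte_fin exprS ifT; last first.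
  by rewrite ltr_pMl ?exprn_gt0// ltr1n.
rewrite -EFinB -EFinM lee_fin E4 powR_mulrn// exprMn.
have -> : 4 * (2 ^+ k) ^+ 2 - (2 ^+ k) ^+ 2 = 3 * (2 ^+ k) ^+ 2 :> R by lra.
rewrite mul2n -addnn (exprD _ (n + n) 2) [leRHS]mulrA ler_wpM2r ?exprn_ge0//.
rewrite mulrAC ler_peMl ?exprn_ge0//.
by rewrite -[leLHS]mulr1 ler_pM ?ler1n// exprn_ege1 ?ler1n.
Qed.

Lemma trivIset_shell : trivIset setT shell.
Proof.
apply/trivIsetP => i j _ _; wlog ij : i j / (i < j)%N.
  move=> H ij; have [lt|lt|eqij] := ltngtP i j; first exact: H.
    by rewrite setIC; apply: H => //; rewrite eq_sym.
  by rewrite eqij eqxx in ij.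
move=> _; rewrite -subset0 => z [[_ /=] + [_ /=]].
rewrite !in_itv/= => /andP[_ zi] /andP[zj _].
have := lt_le_trans zj zi; rewrite ltNge ler_eXn2l ?ltr1n//.
by rewrite ij.
Qed.

End lower_bound.

Lemma integral_shells_infinite d (T : measurableType d) (R : realType)
    (mu : {measure set T -> \bar R}) (F : (set T)^nat) (f : T -> \bar R) (c : R) :
  (forall k, measurable (F k)) -> trivIset setT F -> measurable_fun setT f ->
  (forall x, 0 <= f x)%E -> 0 < c ->
  (forall k, c%:E <= \int[mu]_(x in F k) f x)%E ->
  (\int[mu]_x f x = +oo)%E.
Proof.
move=> mF tF mf f0 c0 cF; apply/eqyP => A A0.
pose N := (Num.truncn (A / c)).+1.
apply: (@le_trans _ _ (\sum_(0 <= k < N) c%:E)%E).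
  rewrite sumEFin lee_fin sumr_const_nat subn0 -mulr_natl -ler_pdivrMr//.
  by rewrite ltW// /N; exact: truncnS_gt.
apply: (@le_trans _ _ (\sum_(0 <= k < N) \int[mu]_(x in F k) f x)%E).
  exact: lee_sum.
rewrite -ge0_integral_bigsetU//.
- apply: ge0_subset_integral => //.
  by apply: bigsetU_measurable.
- exact: iota_uniq.
- exact: sub_trivIset tF.
- exact: measurable_funTS.
Qed.

Section decay.
Context {R : realType} {n : nat}.

(** Separates the constants from the dependence on [X] in the bound of
    [eta2_ge] at the radius [M * X]. *)
Lemma decay_rateE (M X kappa q : R) : 0 < M -> 0 < X -> 0 <= kappa ->
  (M * X) ^- 2 * (kappa / ((2 * (M * X)) ^+ (n + n) * (2 * (M * X) ^+ 2))) `^ q^-1 =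
  M ^- 2 * (kappa / ((2 * M) ^+ (n + n) * (2 * M ^+ 2))) `^ q^-1 *
  X `^ (- (2 + hdim n / q)).
Proof.
move=> M0 X0 k0.
have XQ : X `^ hdim n = X ^+ (n + n) * X ^+ 2.
  by rewrite powR_mulrn ?ltW// -exprD mul2n addnn.
have -> : (2 * (M * X)) ^+ (n + n) * (2 * (M * X) ^+ 2) =
    ((2 * M) ^+ (n + n) * (2 * M ^+ 2)) * X `^ hdim n.
  rewrite XQ [2 * (M * X)]mulrA [(2 * M * X) ^+ _]exprMn.
  by move: ((2 * M) ^+ (n + n)) (X ^+ (n + n)) => u v; ring.
have V0 : 0 < (2 * M) ^+ (n + n) * (2 * M ^+ 2).
  by rewrite !mulr_gt0 ?exprn_gt0 ?mulr_gt0.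
move: ((2 * M) ^+ (n + n) * (2 * M ^+ 2)) V0 => V V0.
have -> : kappa / (V * X `^ hdim n) = (kappa / V) * X `^ (- hdim n).
  by rewrite powRN invfM mulrA.
rewrite powRM ?divr_ge0 ?(ltW V0) ?powR_ge0// -powRrM.
have -> : (M * X) ^- 2 = M ^- 2 * X `^ (- 2).
  by rewrite powRN powR_mulrn ?ltW// exprMn invfM.
by rewrite mulrACA -powRD ?(gt_eqF X0) ?implybT// mulNr -opprD.
Qed.

Lemma N2_shell_ge (q kappa : R) m (g : @heis R n -> R[i]) : 0 < q -> 0 < kappa ->
  (forall h, coset1 q g h -> (kappa%:E <= int_powq q (hcube m) h)%E) ->
  exists2 C : R, 0 < C & forall k z, shell k z ->
    ((C * (2 ^+ k) `^ (- (2 + hdim n / q)))%:E <= N2 q (coset1 q g) z)%E.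
Proof.
move=> q0 k0 far; have [M M0 sub] := @hcube_sub_hball R n m.
exists (M ^- 2 * (kappa / ((2 * M) ^+ (n + n) * (2 * M ^+ 2))) `^ q^-1).
  by rewrite mulr_gt0 ?invr_gt0 ?exprn_gt0// powR_gt0// divr_gt0// !mulr_gt0 ?exprn_gt0 ?mulr_gt0.
move=> k z [z1 /=]; rewrite in_itv/= => /andP[t0 t1].
have X0 : 0 < 2 ^+ k :> R by rewrite exprn_gt0.
rewrite -decay_rateE ?(ltW k0)//.
apply: le_ereal_inf_tmp => _ [h hG <-].
apply: (eta2_ge q h z (M * 2 ^+ k) kappa (hcube m)) => //.
- by rewrite mulr_gt0.
- exact: ltW.
- by case: hG.
- exact: measurable_hcube.
- apply: sub.
  + by rewrite exprn_ege1 ?ler1n.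
  + by move=> i; have := z1 i; rewrite mxE subr0.
  + rewrite ger0_norm; last by apply: le_trans (ltW t0); rewrite exprn_ge0.
    apply: (le_trans t1); rewrite exprS ler_wpM2l//.
    by rewrite -exprM mulnC exprM lerXn2r ?nnegrE ?exprn_ge0// expr2; lra.
- exact: far.
Qed.

End decay.

(** On the [k]-th shell $|f|^p \ge C^p 2^{-kap} \ge C^p 2^{-kQ}$, while the shell
    has measure at least $2^{kQ}$: the lower bound $C^p$ on its contribution does
    not depend on [k]. *)
Lemma not_in_Lp (R : realType) (n : nat) (p a C : R) (f : @heis R n -> \bar R) :
  0 < p -> 0 < C -> p * a <= hdim n ->
  (forall k z, shell k z -> ((C * (2 ^+ k) `^ (- a))%:E <= f z)%E) -> ~ in_Lp p f.
Proof.
move=> p0 C0 pa fC [h [mh fh]]; apply/negP; rewrite -leNgt leye_eq; apply/eqP.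
apply: (@poweR_eqy _ _ p); rewrite poweR_Lnorm ?gt_eqF//.
have mhp : measurable_fun setT (fun z => `|h z| `^ p)%E.
  exact: (measurableT_comp (measurable_poweR p) (measurableT_comp _ mh)).
apply: (@integral_shells_infinite _ _ _ (haar n) shell _ (C `^ p)) => //.
- exact: measurable_shell.
- exact: trivIset_shell.
- by move=> z; exact: poweR_ge0.
- exact: powR_gt0.
move=> k; set X : R := 2 ^+ k.
have X1 : 1 <= X by rewrite exprn_ege1 ?ler1n.
have X0 : 0 < X := lt_le_trans ltr01 X1.
have v0 : 0 <= C * X `^ (- a) by rewrite mulr_ge0 ?powR_ge0 ?ltW.
have mS := @measurable_shell R n k.
apply: (@le_trans _ _ (\int[haar n]_(z in shell k) ((C * X `^ (- a)) `^ p)%:E)%E).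
  rewrite integral_cst//.
  apply: (@le_trans _ _ (((C * X `^ (- a)) `^ p)%:E * (X `^ hdim n)%:E)%E); last first.
    by apply: lee_wpmul2l; [rewrite lee_fin powR_ge0|exact: haar_shell].
  rewrite -EFinM lee_fin powRM ?powR_ge0 ?(ltW C0)// -mulrA ler_peMr ?powR_ge0//.
  rewrite -powRrM -powRD ?(gt_eqF X0) ?implybT//.
  by rewrite -(powRr0 X) ler_powR// mulNr addrC subr_ge0 mulrC.
apply: ae_ge0_le_integral => //.
- by move=> z _; rewrite lee_fin powR_ge0.
- by move=> z _; exact: poweR_ge0.
- exact: measurable_funTS.
apply: filterS fh => z fz Sz.
rewrite -poweR_EFin; apply: gt0_ler_poweR.
- exact: ltW.
- by rewrite in_itv/= lee_fin v0 leey.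
- by rewrite in_itv/= abse_ge0 leey.
by rewrite -fz; apply: le_trans (fC _ _ Sz) (lee_abs _).
Qed.

(** * The zero class *)

Section classes.
Context {R : realType} {n : nat}.

Lemma hpolyD k (P P' : @heis R n -> R[i]) : hpoly k P -> hpoly k P' ->
  hpoly k (fun z => P z + P' z).
Proof.
move=> [c ->] [c' ->]; exists (fun I => c I + c' I); apply/funext => z.
by rewrite -big_split; apply: eq_bigr => I _; rewrite mulrDl.
Qed.

Lemma hpolyN k (P : @heis R n -> R[i]) : hpoly k P -> hpoly k (fun z => - P z).
Proof.
move=> [c ->]; exists (fun I => - c I); apply/funext => z.
by rewrite -sumrN; apply: eq_bigr => I _; rewrite mulNr.
Qed.

Lemma coset1_hpoly (q : R) (g P : @heis R n -> R[i]) : hpoly 1 P ->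
  {ae haar n, forall z, g z = P z} -> coset1 q g = E1_zero q.
Proof.
move=> hP gP; apply/seteqP; split => h [Lh [P' hP' hE]]; split => //.
  exists (fun z => P z + P' z); first exact: hpolyD.
  by apply: filterS2 gP hE => z gz ->; rewrite gz add0r.
exists (fun z => P' z + - P z); first by apply: hpolyD => //; exact: hpolyN.
by apply: filterS2 gP hE => z gz ->; rewrite gz add0r addrC subrK.
Qed.

Lemma int_powq0 (q : R) (B : set (@heis R n)) : q != 0 ->
  int_powq q B (fun=> 0) = 0%E.
Proof.
move=> q0; apply: integral0_eq => z _.
by rewrite Normc.normc0 powR0.
Qed.

Lemma eta2_ge0 (q : R) (g : @heis R n -> R[i]) z : (0 <= eta2 q g z)%E.
Proof.
apply: (@le_trans _ _ ((1 ^- 2)%:E * qmean q (hball z 1) g)%E).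
  by rewrite mule_ge0 ?lee_fin ?poweR_ge0.
by apply: ereal_sup_ubound; exists 1 => /=.
Qed.

Lemma eta2_0 (q : R) (z : @heis R n) : q != 0 -> eta2 q (fun=> 0) z = 0%E.
Proof.
move=> q0; apply/eqP; rewrite eq_le eta2_ge0 andbT.
apply: ge_ereal_sup => _ [r r0 <-].
by rewrite /qmean int_powq0// mule0 poweR0r ?mule0// invr_eq0.
Qed.

Lemma Lq_loc0 (q : R) : q != 0 -> Lq_loc q ((fun=> 0) : @heis R n -> R[i]).
Proof.
move=> q0; split; [exact: measurable_cst|exact: measurable_cst|].
by move=> K _; rewrite int_powq0.
Qed.

Lemma N2_zero (q : R) (z : @heis R n) : q != 0 -> N2 q (E1_zero q) z = 0%E.
Proof.
move=> q0; apply/eqP; rewrite eq_le; apply/andP; split; last first.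
  by apply: le_ereal_inf_tmp => _ [h _ <-]; exact: eta2_ge0.
apply: ereal_inf_lbound; exists (fun=> 0); last exact: eta2_0.
split; first exact: Lq_loc0.
exists (fun=> 0); last by apply: aeW => w; rewrite addr0.
by exists (fun=> 0); apply/funext => w; rewrite big1// => I _; rewrite mul0r.
Qed.

Lemma E1_zero_calderon_hardy (p q : R) : 0 < p -> q != 0 ->
  calderon_hardy (n := n) p q (E1_zero q).
Proof.
move=> p0 q0; split; first by exists (fun=> 0) => //; exact: Lq_loc0.
exists (cst 0%E); split.
- exact: measurable_cst.
- by apply: aeW => z; exact: N2_zero.
by rewrite Lnorm0 ?gt_eqF// ltry.
Qed.

End classes.

(** * Triviality of the small Calderon-Hardy spaces *)

Theorem theorem5p2 (R : realType) (n : nat) (p q : R) :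
  (1 <= n)%N ->
  1 < q -> q < (n.+1)%:R / n%:R ->
  0 < p -> p <= hdim n * (2 + hdim n / q)^-1 ->
  calderon_hardy (n := n) p q = [set E1_zero q].
Proof.
move=> _ q1 _ p0 ple; have q0 : 0 < q := lt_trans ltr01 q1.
apply/seteqP; split => [G|_ ->]; last first.
  by apply: E1_zero_calderon_hardy; rewrite ?gt_eqF.
move=> [[g Lg ->] NG].
have [[P hP gP]|[m [kappa k0 far]]] := coset1_zero_or_far q g q1 Lg.
  exact: coset1_hpoly hP gP.
have [C C0 NC] := N2_shell_ge q kappa m g q0 k0 far.
exfalso; apply: (not_in_Lp _ n p (2 + hdim n / q) C _ p0 C0 _ NC) NG.
by rewrite -ler_pdivlMr// ltr_pwDl// divr_ge0 ?ler0n ?(ltW q0).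
Qed.
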